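(* Let $\rho>1$ be real and let $U,V$ be unitaries generating the rotation C*-algebra $A_\rho$, with $VU=e(\rho)UV$. Then the element $$\sum_{m,n\in\mathbb Z} e^{-\frac\pi2\rho(m^2+n^2)}\,e(\tfrac12\rho mn)\,U^nV^m$$ is positive and invertible in $A_\rho$.
   Context: $e(t):=e^{2\pi it}$. $A_\rho$ is the universal C*-algebra generated by unitaries $U,V$ with $VU=e^{2\pi i\rho}UV$. *)

(* Defs.v *)
From HB Require Import structures.
From mathcomp Require Import all_boot all_order all_algebra.
From mathcomp Require Import all_classical all_reals all_analysis.
From mathcomp Require Import complex.
Set Implicit Arguments. Unset Strict Implicit. Unset Printing Implicit Defensive.
Import Order.TTheory GRing.Theory Num.Theory.
Local Open Scope ring_scope.
Local Open Scope complex_scope.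

Definition ee (R : realType) (t : R) : R[i] :=
  (cos (2 * pi * t)) +i* (sin (2 * pi * t)).

Record cstar_struct (R : realType) (A : algType R[i]) := CStar {
  star : A -> A;
  nrm : A -> R;
  starK : forall x, star (star x) = x;
  starD : forall x y, star (x + y) = star x + star y;
  starZ : forall (a : R[i]) x, star (a *: x) = a^* *: star x;
  starM : forall x y, star (x * y) = star y * star x;
  nrm_ge0 : forall x, 0 <= nrm x;
  nrm_eq0 : forall x, nrm x = 0 -> x = 0;
  nrmD : forall x y, nrm (x + y) <= nrm x + nrm y;
  nrmZ : forall (a : R[i]) x, nrm (a *: x) = Normc.normc a * nrm x;
  nrmM : forall x y, nrm (x * y) <= nrm x * nrm y;
  nrm_cstar : forall x, nrm (star x * x) = nrm x ^+ 2;
  nrm_complete : forall u : nat -> A,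
    (forall e : R, 0 < e -> exists N, forall m n, (N <= m)%N -> (N <= n)%N ->
        nrm (u m - u n) < e) ->
    exists l, forall e : R, 0 < e -> exists N, forall n, (N <= n)%N ->
        nrm (u n - l) < e
}.

Section CStarNotions.
Variables (R : realType) (A : algType R[i]) (S : cstar_struct A).

Definition cvgA (u : nat -> A) (l : A) : Prop :=
  forall e : R, 0 < e -> exists N, forall n, (N <= n)%N -> nrm S (u n - l) < e.

Definition invertible (x : A) : Prop := exists y : A, x * y = 1 /\ y * x = 1.

Definition unitary (u : A) : Prop := star S u * u = 1 /\ u * star S u = 1.

Definition selfadjoint (x : A) : Prop := star S x = x.

Definition spectrum (x : A) : set R[i] :=
  [set lam | ~ invertible (x - lam%:A)].

Definition positive (x : A) : Prop :=
  selfadjoint x /\ forall lam, spectrum x lam -> 0 <= lam.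

Definition upow (u : A) (n : int) : A :=
  match n with
  | Posz k => u ^+ k
  | Negz k => (star S u) ^+ k.+1
  end.

Definition sqsum (f : int -> int -> A) (N : nat) : A :=
  \sum_(i < (N.*2).+1) \sum_(j < (N.*2).+1)
     f (i%:Z - N%:Z) (j%:Z - N%:Z).

End CStarNotions.

(* Main.v *)
(** Put [q = e^(-pi/2)], [r = e^(-pi(rho-1)/2) < 1], and for [l = (m,n)] let [|l|^2 = m^2 + n^2] and [chi l = 1] if
    [m, n] are both even, [-1] otherwise.  The unitaries [w l = chi l e(rho m n / 2) U^n V^m] satisfy
    [w(l)^* = w(-l)] and [w(2l) = w(l)^2], and the element is [x = sum_l chi l q^|l|^2 r^|l|^2 w l].
    With [D l = 1 - r^|l|^2 Re (w l) >= 1 - r^|l|^2] one gets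
    [x = sum_l chi l q^|l|^2 - sum_l chi l q^|l|^2 D l].
    The scalar sum is nonnegative, because [l |-> chi l q^|l|^2] is positive definite on [Z^2]: this is the kernel
    [exp (pi z_l conj(z_l'))] of the Bargmann space.  In the second sum only the terms with [l = 2 l'] have the wrong
    sign, and they are absorbed through [D (2 l) <= 4 D l], which for [rho = 1] is [1 - cos 2t <= 4 (1 - cos t)].
    What is left of the term [l = (1,0)] is bounded below by a positive multiple of [1 - r]. *)
Require Import Defs.
From HB Require Import structures.
From mathcomp Require Import all_boot all_order all_algebra.
From mathcomp Require Import all_classical all_reals all_analysis.
From mathcomp Require Import complex.
From mathcomp Require Import ring lra zify.
Set Implicit Arguments. Unset Strict Implicit. Unset Printing Implicit Defensive.
Import Order.TTheory GRing.Theory Num.Theory.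
Import numFieldNormedType.Exports.
Local Open Scope ring_scope.
Local Open Scope complex_scope.

(** * Lower bounds in a C*-algebra *)

Section CStarFacts.
Variables (R : realType) (A : algType R[i]) (S : cstar_struct A).
Implicit Types (x y z : A) (s c : R).

Lemma star0 : star S 0 = 0.
Proof. by apply: (addrI (star S 0)); rewrite -starD !addr0. Qed.

Lemma starN x : star S (- x) = - star S x.
Proof. by apply: (addrI (star S x)); rewrite -starD !subrr star0. Qed.

Lemma starZc a x : star S (a *: x) = conjc a *: star S x.
Proof. exact: starZ. Qed.

Lemma starZR c x : star S (c%:C *: x) = c%:C *: star S x.
Proof. by rewrite starZc /= oppr0. Qed.

Lemma star_sum (I : Type) (s : seq I) (P : pred I) (F : I -> A) :
  star S (\sum_(i <- s | P i) F i) = \sum_(i <- s | P i) star S (F i).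
Proof. exact: (big_morph (star S) (starD S) star0). Qed.

Lemma star1 : star S 1 = 1.
Proof. by rewrite -[LHS]mul1r -{1}[1](starK S) -starM mul1r starK. Qed.

Lemma star_exp x k : star S (x ^+ k) = star S x ^+ k.
Proof.
elim: k => [|k IH]; first by rewrite !expr0 star1.
by rewrite exprS starM IH -exprSr.
Qed.

Lemma normcR c : Normc.normc (c%:C) = `|c|.
Proof. by rewrite /= expr0n /= addr0 sqrtr_sqr. Qed.

Lemma nrmZR c x : nrm S (c%:C *: x) = `|c| * nrm S x.
Proof. by rewrite nrmZ normcR. Qed.

Lemma nrm0 : nrm S 0 = 0.
Proof. by rewrite -[X in nrm S X](scale0r (0 : A)) (nrmZR 0) normr0 mul0r. Qed.

Lemma nrmN x : nrm S (- x) = nrm S x.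
Proof.
by rewrite -scaleN1r -(rmorphN1 (real_complex R)) nrmZR normrN1 mul1r.
Qed.

Lemma nrm_sub x y : nrm S (x - y) = nrm S (y - x).
Proof. by rewrite -nrmN opprB. Qed.

(** The C*-identity gives [|y|^2 <= |y^*| |y|], hence [|y| <= |y^*|]; applied to [x] and to
    [star S x] this becomes an equality. *)
Lemma nrm_star x : nrm S (star S x) = nrm S x.
Proof.
have H y : nrm S y <= nrm S (star S y).
  have := nrmM S (star S y) y; rewrite nrm_cstar expr2.
  have := nrm_ge0 S y; rewrite le_eqVlt => /orP[/eqP <-|y0]; last first.
    by rewrite ler_pM2r.
  by rewrite nrm_ge0.
by apply/eqP; rewrite eq_le H andbT -{2}[x](starK S) H.
Qed.

Lemma nrm1 : nrm S 1 = 1.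
Proof.
have n0 : nrm S 1 != 0.
  by apply/eqP => /nrm_eq0 /eqP; rewrite oner_eq0.
by apply: (mulfI n0); rewrite -expr2 -nrm_cstar star1 !mulr1.
Qed.

Lemma nrmR c : nrm S (c%:C *: 1) = `|c|.
Proof. by rewrite nrmZR nrm1 mulr1. Qed.

Lemma nrm_sum (I : Type) (s : seq I) (P : pred I) (F : I -> A) :
  nrm S (\sum_(i <- s | P i) F i) <= \sum_(i <- s | P i) nrm S (F i).
Proof.
elim/big_rec2: _ => [|i y1 y2 _ H]; first by rewrite nrm0.
by apply: le_trans (nrmD _ _ _) _; rewrite lerD2l.
Qed.

Lemma nrmX x k : nrm S (x ^+ k) <= nrm S x ^+ k.
Proof.
elim: k => [|k IH]; first by rewrite !expr0 nrm1.
by rewrite !exprS (le_trans (nrmM _ _ _)) // ler_wpM2l ?nrm_ge0.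
Qed.

Lemma nrm_unitary x : unitary S x -> nrm S x = 1.
Proof.
move=> [x1 _]; have := nrm_cstar S x; rewrite x1 nrm1 => /esym/eqP.
by rewrite sqrf_eq1 => /orP[/eqP //|/eqP H]; have := nrm_ge0 S x; lra.
Qed.

Lemma nrm_small x : (forall e : R, 0 < e -> nrm S x < e) -> x = 0.
Proof.
move=> H; apply: (nrm_eq0 (c := S)); apply/eqP; rewrite eq_le nrm_ge0 andbT.
by rewrite leNgt; apply/negP => /H; rewrite ltxx.
Qed.

Lemma invertible_of_inverses x y z : x * y = 1 -> z * x = 1 -> invertible x.
Proof.
move=> xy zx; exists y; split=> //.
by rewrite (_ : y = z) // -[y]mul1r -zx -mulrA xy mulr1.
Qed.

(** Geometric series: the partial sums [u n] are Cauchy and their limit inverts [1 - x]. *)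
Lemma Neumann x : nrm S x < 1 -> invertible (1 - x).
Proof.
move=> x1; set k := nrm S x in x1; have k0 : 0 <= k by exact: nrm_ge0.
pose u n := \sum_(i < n) x ^+ i.
have tele n : (1 - x) * u n = 1 - x ^+ n /\ u n * (1 - x) = 1 - x ^+ n.
  rewrite /u; elim: n => [|n [IH1 IH2]].
    by rewrite big_ord0 mulr0 mul0r expr0 subrr.
  rewrite big_ord_recr /= (mulrDr (1 - x)) (mulrDl _ _ (1 - x)) IH1 IH2 mulrBl mulrBr mul1r mulr1.
  by rewrite -exprS -exprSr !addrA !subrK.
have bnd m n : (n <= m)%N -> (1 - k) * nrm S (u m - u n) <= k ^+ n.
  move=> nm; have : nrm S (u m - u n) <= \sum_(n <= i < m) k ^+ i.
    rewrite /u -!(big_mkord xpredT (fun i => x ^+ i)) (big_cat_nat _ nm) //=.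
    rewrite addrAC subrr add0r; apply: le_trans (nrm_sum _ _ _) _.
    by apply: ler_sum => i _; exact: nrmX.
  move=> H; have: (1 - k) * nrm S (u m - u n)
      <= (1 - k) * \sum_(n <= i < m) k ^+ i.
    by rewrite ler_wpM2l // subr_ge0 ltW.
  move/le_trans; apply.
  have -> : (1 - k) * \sum_(n <= i < m) k ^+ i = k ^+ n - k ^+ m.
    elim: m nm {H} => [|m IH]; first by rewrite leqn0 => /eqP ->; rewrite big_geq // mulr0 subrr.
    rewrite leq_eqVlt => /orP[/eqP ->|]; first by rewrite big_geq // mulr0 subrr.
    rewrite ltnS => nm; rewrite big_nat_recr //= mulrDr IH // exprS.
    ring.
  by rewrite gerBl exprn_ge0.
have small (e : R) : 0 < e -> exists N, forall n, (N <= n)%N -> k ^+ n < e.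
  move=> e0; have : (k ^+ n @[n --> \oo] --> 0)%classic by apply: cvg_expr; rewrite ger0_norm.
  move=> /cvgrPdist_lt /(_ e e0) [N _ HN]; exists N => n Nn.
  have := HN n Nn; rewrite /= sub0r normrN ger0_norm // exprn_ge0 //.
have k1 : 0 < 1 - k by rewrite subr_gt0.
have [y Hy] : exists y, cvgA S u y.
  apply: nrm_complete => e e0.
  have [N HN] := small ((1 - k) * e) (mulr_gt0 k1 e0); exists N => m n.
  wlog nm : m n / (n <= m)%N.
    move=> W Nm Nn; case: (leqP n m) => [H|/ltnW H]; first exact: W.
    by rewrite nrm_sub; exact: W.
  move=> Nm Nn; rewrite -(ltr_pM2l k1).
  by apply: le_lt_trans (bnd _ _ nm) _; exact: HN.
(* The two errors at stage [n], the product of [1 - x] with [y - u n] and the power [x^n], get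
   [e / 2] each. The added 1 keeps the denominator positive. *)
have lim (e : R) : 0 < e -> exists n, nrm S (u n - y) < e / 2 / (1 + nrm S (1 - x)) /\ k ^+ n < e / 2.
  move=> e0; have d0 : 0 < e / 2 / (1 + nrm S (1 - x)).
    by rewrite !divr_gt0 // ltr_wpDr // nrm_ge0.
  have e20 : 0 < e / 2 by rewrite divr_gt0.
  have [N1 H1] := Hy _ d0; have [N2 H2] := small _ e20.
  exists (maxn N1 N2); split; first by apply: H1; rewrite leq_maxl.
  by apply: H2; rewrite leq_maxr.
have fin (e a : R) n (v : A) : 0 < e -> a < e / 2 / (1 + nrm S (1 - x)) -> 0 <= a ->
    k ^+ n < e / 2 -> nrm S v <= nrm S (1 - x) * a + k ^+ n -> nrm S v < e.
  move=> e0 ha a0 hk /le_lt_trans; apply.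
  have p0 : 0 < 1 + nrm S (1 - x) by rewrite ltr_wpDr // nrm_ge0.
  move: ha; rewrite ltr_pdivlMr // mulrDr mulr1 => ha.
  by rewrite mulrC; lra.
exists y; split; apply/eqP; rewrite -subr_eq0; apply/eqP/nrm_small => e e0.
- have [n [n1 n2]] := lim e e0; apply: (fin e _ n _ e0 n1) => //; first exact: nrm_ge0.
  rewrite (_ : (1 - x) * y - 1 = (1 - x) * (y - u n) - x ^+ n); last first.
    by rewrite [in RHS]mulrBr (tele n).1 opprB addrA addrAC addrK.
  apply: le_trans (nrmD _ _ _) _; rewrite nrmN; apply: lerD; last exact: nrmX.
  by rewrite -(nrm_sub y) nrmM.
- have [n [n1 n2]] := lim e e0; apply: (fin e _ n _ e0 n1) => //; first exact: nrm_ge0.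
  rewrite (_ : y * (1 - x) - 1 = (y - u n) * (1 - x) - x ^+ n); last first.
    by rewrite [in RHS]mulrBl (tele n).2 opprB addrA addrAC addrK.
  apply: le_trans (nrmD _ _ _) _; rewrite nrmN; apply: lerD; last exact: nrmX.
  by rewrite -(nrm_sub y) [leRHS]mulrC nrmM.
Qed.

Lemma half_double x : (2^-1)%:C *: (x + x) = x.
Proof.
rewrite -mulr2n -[x *+ 2]scaler_nat scalerA -(rmorph_nat (real_complex R)) -rmorphM.
by rewrite mulVf // rmorph1 scale1r.
Qed.

(** This reduces invertibility of [x - lam] at a non-real [lam] to that of a sum of squares, and
    computes [v^* v] in [lower_bound_sqr]. *)
Lemma sum_squares_factor x y : x * y = y * x ->
  (x - 'i *: y) * (x + 'i *: y) = x ^+ 2 + y ^+ 2 /\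
  (x + 'i *: y) * (x - 'i *: y) = x ^+ 2 + y ^+ 2.
Proof.
move=> xy; have ii : 'i * 'i = -1 :> R[i] by rewrite -expr2 sqr_i.
split; rewrite !(mulrDr, mulrDl) !(mulrN, mulNr) -!(scalerAl, scalerAr) scalerA ii.
- by rewrite scaleN1r opprK xy -!expr2 !addrA addrNK.
- by rewrite scaleN1r opprK xy -!expr2 !addrA addrK.
Qed.

(* First-order form of [x >= c] for self-adjoint [x]; it needs no spectral theory, and makes [x >= c] additive. *)
Definition lower_bound x c := exists C : R, forall s : R, 0 <= s ->
  nrm S (1 - s%:C *: x) <= 1 - c * s + C * s ^+ 2.

(** [1 - s (x + y)] is the mean of [1 - 2 s x] and [1 - 2 s y]; doubling [s] only enlarges the
    quadratic constant. *)
Lemma lower_boundD x y c d :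
  lower_bound x c -> lower_bound y d -> lower_bound (x + y) (c + d).
Proof.
move=> [C HC] [D HD]; exists (2 * C + 2 * D) => s s0.
have s20 : 0 <= 2 * s by rewrite mulr_ge0.
have -> : 1 - s%:C *: (x + y) =
    (2^-1)%:C *: ((1 - (2 * s)%:C *: x) + (1 - (2 * s)%:C *: y)).
  rewrite addrACA -opprD scalerBr half_double -(scalerDr (2 * s)%:C) scalerA.
  by rewrite -rmorphM mulrA mulVf // mul1r.
rewrite nrmZR ger0_norm ?invr_ge0 // mulrC ler_pdivrMr //.
apply: le_trans (nrmD _ _ _) _; apply: le_trans (lerD (HC _ s20) (HD _ s20)) _.
by rewrite le_eqVlt; apply/orP; left; apply/eqP; ring.
Qed.

Lemma lower_boundZ x c k : 0 <= k ->
  lower_bound x c -> lower_bound (k%:C *: x) (k * c).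
Proof.
move=> k0 [C HC]; exists (C * k ^+ 2) => s s0.
rewrite scalerA -rmorphM; apply: le_trans (HC (s * k) (mulr_ge0 s0 k0)) _.
by rewrite le_eqVlt; apply/orP; left; apply/eqP; ring.
Qed.

Lemma lower_bound_mono x c d : d <= c -> lower_bound x c -> lower_bound x d.
Proof.
move=> dc [C HC]; exists C => s s0; apply: le_trans (HC s s0) _.
by rewrite lerD2r lerD2l lerN2 ler_wpM2r.
Qed.

Lemma lower_boundR c : lower_bound (c%:C *: 1) c.
Proof.
(* With [t = c s], the inequality [|1 - t| <= 1 - t + t^2] holds for every real [t], also beyond
   [t = 1]. *)
exists (c ^+ 2) => s s0.
have -> : 1 - s%:C *: (c%:C *: 1) = (1 - s * c)%:C *: (1 : A).
  by rewrite scalerA -rmorphM rmorphB rmorph1 scalerBl scale1r.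
rewrite nrmR ler_norml; apply/andP; split; nra.
Qed.

Lemma lower_bound0 : lower_bound 0 0.
Proof. by have := lower_boundR 0; rewrite scale0r. Qed.

Lemma lower_bound_nrm x : lower_bound x (- nrm S x).
Proof.
exists 0 => s s0; apply: le_trans (nrmD _ _ _) _.
by rewrite nrmN nrmZR nrm1 ger0_norm // mul0r addr0 mulNr opprK mulrC.
Qed.

Lemma lower_bound_sum (I : Type) (r : seq I) (P : pred I) (F : I -> A) (f : I -> R) :
  (forall i, P i -> lower_bound (F i) (f i)) ->
  lower_bound (\sum_(i <- r | P i) F i) (\sum_(i <- r | P i) f i).
Proof.
move=> H; elim/big_rec2: _ => [|i c y Pi IH].
  exact: lower_bound0.
by apply: lower_boundD => //; exact: H.
Qed.

(* [1 - s x^2] is the real part of [1 - s x^2 + i sqrt (2 s) x], an element that is unitary up to [O(s^2)]. *)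
Lemma lower_bound_sqr x : selfadjoint S x -> lower_bound (x ^+ 2) 0.
Proof.
move=> xx; exists (nrm S x ^+ 4) => s s0; rewrite mul0r subr0.
set p := 1 - s%:C *: x ^+ 2; pose k := (Num.sqrt (2 * s))%:C *: x.
have ps : star S p = p by rewrite /p starD starN starZR star1 star_exp xx.
have ks : star S k = k by rewrite /k starZR xx.
have pk : p * k = k * p.
  rewrite /p /k mulrBl mulrBr mul1r mulr1 -!(scalerAl, scalerAr) -exprSr -exprS.
  by rewrite !scalerA [X in _ - X *: _]mulrC.
pose v := p + 'i *: k.
have sv : star S v = p - 'i *: k.
  rewrite /v starD starZc ps ks -scaleNr; congr (_ + _ *: _).
  by apply/eqP; rewrite eq_complex /= oppr0 !eqxx.
(* The factor [sqrt (2 s)] cancels the terms of order [s]: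
   [(1 - s x^2)^2 + 2 s x^2 = 1 + s^2 x^4]. *)
have vv : star S v * v = 1 + (s ^+ 2)%:C *: x ^+ 4.
  rewrite sv (sum_squares_factor pk).1 /p /k exprZn -rmorphXn sqr_sqrtr ?mulr_ge0 //.
  have -> : (2 * s)%:C *: x ^+ 2 = (s%:C *: x ^+ 2) *+ 2.
    by rewrite rmorphM rmorph_nat -scalerA scaler_nat.
  by rewrite -sqrrN opprB sqrrB1 exprZn -exprM -rmorphXn addrAC subrK addrC.
have nv : nrm S p <= nrm S v.
  have -> : p = (2^-1)%:C *: (v + star S v).
    by rewrite sv /v addrACA subrr addr0 half_double.
  rewrite nrmZR ger0_norm ?invr_ge0 // mulrC ler_pdivrMr //.
  by apply: le_trans (nrmD _ _ _) _; rewrite nrm_star; lra.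
apply: le_trans nv _.
have v2 : nrm S v ^+ 2 <= 1 + s ^+ 2 * nrm S x ^+ 4.
  rewrite -nrm_cstar vv; apply: le_trans (nrmD _ _ _) _.
  rewrite nrm1 lerD2l nrmZR ger0_norm ?exprn_ge0 // ler_wpM2l ?exprn_ge0 //.
  exact: nrmX.
have v0 := nrm_ge0 S v; have t0 : 0 <= s ^+ 2 * nrm S x ^+ 4.
  by rewrite mulr_ge0 ?exprn_ge0 // nrm_ge0.
by rewrite mulrC; nra.
Qed.

Lemma lower_bound_invertible x c : 0 < c -> lower_bound x c -> invertible x.
Proof.
(* This [s] makes [C s^2 <= c s / 2], so half of the gain [c s] survives; the [+ 1] keeps [K]
   positive even if [C = 0]. *)
move=> c0 [C HC]; pose K := `|C| + 1; pose s := c / (2 * K).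
have K0 : 0 < K by rewrite ltr_wpDl.
have s0 : 0 < s by rewrite divr_gt0 // mulr_gt0.
have CK : C <= K by apply: le_trans (ler_norm _) _; rewrite lerDl.
have H : nrm S (1 - s%:C *: x) < 1.
  apply: le_lt_trans (HC s (ltW s0)) _.
  have e : K * s = c / 2 by rewrite /s; field; rewrite gt_eqF.
  have : C * s ^+ 2 <= K * s ^+ 2 by rewrite ler_wpM2r // exprn_ge0 // ltW.
  have -> : K * s ^+ 2 = c / 2 * s by rewrite expr2 mulrA e.
  have : 0 < c * s by rewrite mulr_gt0.
  lra.
have [y [y1 y2]] := Neumann H; move: y1 y2; rewrite opprB addrC subrK => y1 y2.
exists (s%:C *: y); split; first by rewrite -scalerAr scalerAl.
by rewrite -scalerAl scalerAr.
Qed.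

Lemma lower_bound_positive x c : selfadjoint S x -> 0 < c ->
  lower_bound x c -> positive S x /\ invertible x.
Proof.
move=> xx c0 H; split; last exact: (lower_bound_invertible c0).
split=> // lam Hlam; case: lam Hlam => a b Hlam; rewrite lecE /=.
(* For [b <> 0], [x - lam] is a factor of [(x - a)^2 + b^2], which is bounded below by [b^2 > 0] and
   hence invertible. *)
have [b0|b0] := eqVneq b 0; last first.
  exfalso; apply: Hlam.
  pose y := x - a%:C *: 1; pose z : A := b%:C *: 1.
  have yz : y * z = z * y by rewrite /z -scalerAr -scalerAl mulr1 mul1r.
  have -> : x - (a +i* b)%:A = y - 'i *: z.
    rewrite /y /z scalerA -addrA -opprD -scalerDl; congr (_ - _ *: _).
    by apply/eqP; rewrite eq_complex /= !(mul0r, mul1r, mulr0, subr0, addr0, add0r) !eqxx.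
  have [F1 F2] := sum_squares_factor yz.
  have [w [w1 w2]] : invertible (y ^+ 2 + z ^+ 2).
    have b2 : 0 < b ^+ 2 by rewrite exprn_even_gt0.
    apply: (lower_bound_invertible b2); rewrite -[b ^+ 2]add0r; apply: lower_boundD.
      apply: lower_bound_sqr.
      by rewrite /selfadjoint /y starD starN starZR star1 xx.
    by rewrite /z exprZn expr1n -rmorphXn; exact: lower_boundR.
  apply: (@invertible_of_inverses _ ((y + 'i *: z) * w) (w * (y + 'i *: z))).
    by rewrite mulrA F1.
  by rewrite -mulrA F2.
(* For real [a < 0], [x - a] is bounded below by [c - a > 0]. *)
rewrite /= leNgt; apply/negP => a0; apply: Hlam; rewrite b0.
have ca : 0 < c - a by rewrite subr_gt0 (lt_trans a0).
apply: (lower_bound_invertible ca); apply: lower_boundD => //.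
rewrite -scaleNr (_ : - (a +i* 0) = (- a)%:C); first exact: lower_boundR.
by apply/eqP; rewrite eq_complex /= oppr0 !eqxx.
Qed.

End CStarFacts.

(** * Positive definiteness of the Gaussian kernel *)

Section GaussianKernel.
Variable R : realType.
Implicit Types (x y : R) (z w : R[i]).
Local Notation Re := complex.Re.
Local Notation Im := complex.Im.
Local Notation normc := Normc.normc.

Lemma normc_ge0 z : 0 <= normc z.
Proof. by case: z => a b; exact: sqrtr_ge0. Qed.

Lemma sqr_normc z : normc z ^+ 2 = Re z ^+ 2 + Im z ^+ 2.
Proof. by case: z => a b; rewrite /= sqr_sqrtr // addr_ge0 ?sqr_ge0. Qed.

Lemma Re_le_normc z : `|Re z| <= normc z.
Proof. by case: z => a b; rewrite /= -sqrtr_sqr ler_wsqrtr // lerDl sqr_ge0. Qed.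

Lemma Im_le_normc z : `|Im z| <= normc z.
Proof. by case: z => a b; rewrite /= -sqrtr_sqr ler_wsqrtr // lerDr sqr_ge0. Qed.

Lemma normc_le z : normc z <= `|Re z| + `|Im z|.
Proof.
rewrite -(ler_pXn2r (n := 2)) ?nnegrE ?normc_ge0 ?addr_ge0 //.
rewrite sqr_normc sqrrD !real_normK ?num_real //.
by rewrite addrAC lerDl mulrn_wge0 // mulr_ge0.
Qed.

Lemma normcD z w : normc (z + w) <= normc z + normc w.
Proof. exact: le_normcD. Qed.

Lemma normcX z n : normc (z ^+ n) = normc z ^+ n.
Proof.
elim: n => [|n IH]; first by rewrite !expr0 Normc.normc1.
by rewrite !exprS Normc.normcM IH.
Qed.

(** Mean value theorem, three times: [|sin t| <= |t|] bounds the derivative of [cos], and the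
    resulting bound on [cos t - 1] is one on the derivative of [sin t - t]. *)
Lemma norm_cos_sub1 x : `|cos x - 1| <= x ^+ 2 /\ `|sin x - x| <= `|x| ^+ 3.
Proof.
have is_d (f f' : R -> R) : (forall t : R, is_derive t (1 : R) f (f' t)) -> forall t : R,
    exists2 u, `|u| <= `|t| & f t - f 0 = f' u * t.
  move=> df t; have cf : continuous f.
    by move=> u; apply: differentiable_continuous; apply/derivable1_diffP; case: (df u).
  have [t0|t0] := leP 0 t.
    have [u] := @MVT_segment R f f' 0 t t0 (fun x _ => df x) (continuous_subspaceT cf).
    rewrite in_itv /= subr0 => /andP[u0 ut] e; exists u => //.
    by rewrite !ger0_norm.
  have [u] := @MVT_segment R f f' t 0 (ltW t0) (fun x _ => df x) (continuous_subspaceT cf).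
  rewrite in_itv /= sub0r => /andP[ut u0] e; exists u.
    by rewrite !ler0_norm ?lerN2 // ltW.
  by rewrite -opprB e mulrN opprK.
have hs (t : R) : `|sin t| <= `|t|.
  have [u _] := is_d sin cos (@is_derive_sin R) t.
  rewrite sin0 subr0 => ->; rewrite normrM ler_piMl //.
  by rewrite ler_norml cos_geN1 cos_le1.
have hc (t : R) : `|cos t - 1| <= t ^+ 2.
  have [u ut] := is_d cos (fun t => - sin t) (@is_derive_cos R) t.
  rewrite cos0 => ->; rewrite normrM normrN -real_normK ?num_real // expr2.
  by rewrite ler_wpM2r // (le_trans (hs u)).
split=> //.
have df (t : R) : is_derive t (1 : R) (fun v => sin v - v) (cos t - 1).
  by apply: is_deriveB.
have [u ut] := is_d _ _ df x.
rewrite sin0 !subr0 => ->; rewrite normrM exprSr ler_wpM2r //.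
apply: le_trans (hc u) _; rewrite -real_normK ?num_real //.
by rewrite ler_pXn2r ?nnegrE.
Qed.

(** * The complex exponential and Euler's limit *)

Definition cexp z : R[i] :=
  (expR (Re z) * cos (Im z)) +i* (expR (Re z) * sin (Im z)).

Lemma cexpD z w : cexp (z + w) = cexp z * cexp w.
Proof.
case: z w => [a b] [c d]; apply/eqP; rewrite eq_complex /= expRD cosD sinD.
by apply/andP; split; apply/eqP; ring.
Qed.

Lemma cexp0 : cexp 0 = 1.
Proof. by apply/eqP; rewrite eq_complex /= expR0 cos0 sin0 mulr1 mulr0 !eqxx. Qed.

Lemma cexpX z n : cexp z ^+ n = cexp (n%:R * z).
Proof.
elim: n => [|n IH]; first by rewrite mul0r expr0 cexp0.
by rewrite exprS IH -cexpD -natr1 mulrDl mul1r addrC.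
Qed.

Lemma normc_cexp z : normc (cexp z) = expR (Re z).
Proof.
apply/eqP; rewrite -(eqrXn2 (n := 2)) ?normc_ge0 ?expR_ge0 // sqr_normc /=.
by rewrite !exprMn -mulrDr cos2Dsin2 mulr1.
Qed.

Lemma cexp_taylor1 z : normc z <= 2^-1 ->
  normc (cexp z - (1 + z)) <= 4 * normc z ^+ 2.
Proof.
move=> z2; rewrite sqr_normc; apply: le_trans (normc_le _) _.
have := le_trans (Re_le_normc z) z2; have := le_trans (Im_le_normc z) z2.
case: z {z2} => a b /=; rewrite add0r !ler_norml => /andP[b1 b2] /andP[a1 a2].
have [] := norm_cos_sub1 b; rewrite !ler_norml => /andP[c1 c2] /andP[s1 s2].
have b3 : `|b| ^+ 3 <= b ^+ 2 / 2.
  rewrite exprSr real_normK ?num_real // ler_wpM2l ?sqr_ge0 //.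
  by rewrite ler_norml b1 b2.
have e1 := expR_ge1Dx a; have e0 := expR_gt0 a.
(* Follows from [1 - a <= exp (- a)]. For [|a| <= 1/2] it reads [E <= 1 / (1 - a)], whence [E <= 2]
   and [E - 1 - a <= a^2 / (1 - a) <= 2 a^2]. *)
have e2 : expR a * (1 - a) <= 1.
  by rewrite -[leRHS](expRxMexpNx_1 a) ler_pM2l // expR_ge1Dx.
set E := expR a in e1 e0 e2 *; set C := cos b in c1 c2 *; set D := sin b in s1 s2 *.
have E2 : E <= 2 by nra.
have e3 : E - 1 - a <= 2 * a ^+ 2 by nra.
have -> : E * C - (1 + a) = (E - 1 - a) + E * (C - 1) by ring.
have -> : E * D - b = E * (D - b) + (E - 1) * b by ring.
have EM x y : `|x| <= y -> `|E * x| <= 2 * y.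
  move=> xy; rewrite normrM gtr0_norm //; apply: ler_pM => //; exact: ltW.
have h1 : `|(E - 1 - a) + E * (C - 1)| <= 2 * a ^+ 2 + 2 * b ^+ 2.
  apply: le_trans (ler_normD _ _) _; apply: lerD; last by apply: EM; rewrite ler_norml c1 c2.
  by rewrite ger0_norm //; lra.
have h2 : `|E * (D - b)| <= b ^+ 2.
  apply: le_trans (EM _ (b ^+ 2 / 2) _) _; last by rewrite mulrC mulfVK.
  apply: le_trans b3; rewrite ler_norml; exact/andP.
have h3 : `|(E - 1) * b| <= a ^+ 2 + b ^+ 2.
  have : `|E - 1| <= 2 * `|a|.
    have a4 : `|a| <= 2^-1 by rewrite ler_norml a1 a2.
    have aa : 2 * a ^+ 2 <= `|a|.
      by rewrite -real_normK ?num_real // expr2; have := normr_ge0 a; nra.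
    have := ler_norm a; have := ler_norm (- a); rewrite normrN => n1 n2.
    rewrite ler_norml; apply/andP; split; lra.
  rewrite normrM -(real_normK (num_real a)) -(real_normK (num_real b)).
  move: (normr_ge0 a) (normr_ge0 b) (normr_ge0 (E - 1)).
  move: `|a| `|b| `|E - 1| => p q r p0 q0 r0 rp.
  apply: (@le_trans _ _ (2 * p * q)); first exact: ler_wpM2r.
  by have := sqr_ge0 (p - q); nra.
by have := ler_normD (E * (D - b)) ((E - 1) * b); lra.
Qed.

(** Telescoping of [z^n - w^n]. The power [M^n] instead of [M^(n-1)], paid for by [1 <= M], avoids a
    separate case [n = 0]. *)
Lemma subX_normc_le z w (M : R) n : 1 <= M -> normc z <= M -> normc w <= M ->
  normc (z ^+ n - w ^+ n) <= n%:R * normc (z - w) * M ^+ n.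
Proof.
move=> M1 zM wM; have M0 : 0 <= M by exact: le_trans M1.
elim: n => [|n IH]; first by rewrite !expr0 subrr Normc.normc0 !mul0r.
have -> : z ^+ n.+1 - w ^+ n.+1 = z * (z ^+ n - w ^+ n) + (z - w) * w ^+ n.
  by rewrite !exprS; ring.
apply: le_trans (normcD _ _) _; rewrite !Normc.normcM normcX.
rewrite -natr1 mulrDl mul1r mulrDl; apply: lerD.
  rewrite exprS mulrCA; apply: ler_pM => //; exact: normc_ge0.
apply: ler_wpM2l; first exact: normc_ge0.
apply: (le_trans (lerXn2r n _ _ wM)); rewrite ?nnegrE ?normc_ge0 //.
by rewrite exprS ler_peMl // exprn_ge0.
Qed.

(** With [w = z / (n+1)], both [exp w] and [1 + w] have modulus at most [exp |w|] and differ by at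
    most [4 |w|^2]; [subX_normc_le] compares their powers. *)
Lemma cexp_euler z (n : nat) : 2 * normc z <= n.+1%:R ->
  normc (cexp z - (1 + n.+1%:R^-1 * z) ^+ n.+1)
    <= 4 * normc z ^+ 2 * expR (normc z) / n.+1%:R.
Proof.
move=> zn; set N : R := n.+1%:R in zn *; have N0 : 0 < N by rewrite ltr0n.
pose w : R[i] := n.+1%:R^-1 * z.
have wz : n.+1%:R * w = z by rewrite mulrA divff ?mul1r // pnatr_eq0.
have nN : normc (n.+1%:R : R[i]) = N.
  by rewrite -(rmorph_nat (real_complex R)) /= expr0n addr0 sqrtr_sqr gtr0_norm.
have nw : N * normc w = normc z by rewrite -nN -Normc.normcM wz.
have nw' : normc w = normc z / N by rewrite -nw mulrC mulKf // gt_eqF.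
have w2 : normc w <= 2^-1.
  by rewrite nw' ler_pdivrMr // mulrC ler_pdivlMr // mulrC.
rewrite -/w -[in cexp z]wz -cexpX.
have H : normc (cexp w ^+ n.+1 - (1 + w) ^+ n.+1) <=
    n.+1%:R * normc (cexp w - (1 + w)) * expR (normc w) ^+ n.+1.
  apply: subX_normc_le.
  - by rewrite -expR0 ler_expR normc_ge0.
  - by rewrite normc_cexp ler_expR (le_trans (ler_norm _)) // Re_le_normc.
  - by apply: le_trans (normcD _ _) _; rewrite Normc.normc1 expR_ge1Dx.
apply: le_trans H _; rewrite -/N -expRM_natl -/N nw.
rewrite [leRHS]mulrAC ler_wpM2r ?expR_ge0 //.
have := cexp_taylor1 w2; rewrite -(ler_pM2l N0) => /le_trans; apply.
rewrite nw' le_eqVlt; apply/orP; left; apply/eqP; field.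
by rewrite gt_eqF.
Qed.

Lemma euler_cvg z :
  (Re ((1 + n.+1%:R^-1 * z) ^+ n.+1) @[n --> \oo] --> Re (cexp z))%classic.
Proof.
pose K := 4 * normc z ^+ 2 * expR (normc z).
have K0 : 0 <= K by rewrite !mulr_ge0 ?expR_ge0 ?exprn_ge0 ?normc_ge0.
apply/cvgrPdist_le => e e0.
near=> n.
apply: le_trans (_ : K / n.+1%:R <= e).
  apply: (le_trans _ (@cexp_euler z n _)); last first.
    apply: le_trans (_ : n%:R <= _); last by rewrite ler_nat.
    by near: n; exact: nbhs_infty_ger.
  by rewrite -raddfB; exact: Re_le_normc.
rewrite ler_pdivrMr ?ltr0n // mulrC -ler_pdivrMr //.
apply: le_trans (_ : n%:R <= _); last by rewrite ler_nat.
by near: n; exact: nbhs_infty_ger.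
Unshelve. all: by end_near.
Qed.

(** Induction on [n] for all [c] at once: one factor [1 + t z_i conj(z_j)] splits the form into the
    same form at [c_i] plus [t] times the form at [c_i z_i]. *)
Lemma pow_kernel_ge0 (I : finType) (t : R) (z : I -> R[i]) n (c : I -> R[i]) :
  0 <= t ->
  0 <= \sum_i \sum_j c i * Num.conj (c j) * (1 + t%:C * (z i * Num.conj (z j))) ^+ n.
Proof.
move=> t0; elim: n c => [|n IH] c.
  rewrite (_ : \sum_i _ = (\sum_i c i) * Num.conj (\sum_i c i)); first exact: mul_conjC_ge0.
  rewrite rmorph_sum mulr_suml; apply: eq_bigr => i _; rewrite mulr_sumr.
  by apply: eq_bigr => j _; rewrite expr0 mulr1.
rewrite (_ : \sum_i _ = (\sum_i \sum_j c i * Num.conj (c j) *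
      (1 + t%:C * (z i * Num.conj (z j))) ^+ n) +
    t%:C * (\sum_i \sum_j (c i * z i) * Num.conj (c j * z j) *
      (1 + t%:C * (z i * Num.conj (z j))) ^+ n)).
  apply: addr_ge0; first exact: IH.
  by apply: mulr_ge0; [rewrite lecE /= eqxx | exact: (IH (fun i => c i * z i))].
rewrite mulr_sumr -big_split /=; apply: eq_bigr => i _.
rewrite mulr_sumr -big_split /=; apply: eq_bigr => j _.
by rewrite exprS rmorphM; ring.
Qed.

(** The real part of the kernel [exp (t z_i conj(z_j))], [z = a + i b], which by Euler's limit is
    approached by the kernels of [pow_kernel_ge0] with [t / (n+1)] for [t]. *)
Lemma gaussian_kernel_ge0 (I : finType) (t : R) (c a b : I -> R) : 0 <= t ->
  0 <= \sum_i \sum_j c i * c j *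
    (expR (t * (a i * a j + b i * b j)) * cos (t * (b i * a j - a i * b j))).
Proof.
move=> t0; pose z i := a i +i* b i.
pose u i j := t%:C * (z i * Num.conj (z j)).
have uE i j : u i j = (t * (a i * a j + b i * b j)) +i* (t * (b i * a j - a i * b j)).
  by apply/eqP; rewrite eq_complex /=; apply/andP; split; apply/eqP; ring.
have cv : ((\sum_i \sum_j c i * c j * Re ((1 + n.+1%:R^-1 * u i j) ^+ n.+1))
    @[n --> \oo] --> \sum_i \sum_j c i * c j * Re (cexp (u i j)))%classic.
  apply: cvg_big => [|i _]; first exact: add_continuous.
  apply: cvg_big => [|j _]; first exact: add_continuous.
  by apply: cvgMl_tmp; exact: euler_cvg.
rewrite (_ : \sum_i _ = \sum_i \sum_j c i * c j * Re (cexp (u i j))); last first.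
  by apply: eq_bigr => i _; apply: eq_bigr => j _; rewrite uE.
apply: (cvgr_to_ge cv).
apply: nearW => n.
have N0 : 0 <= t / n.+1%:R by rewrite divr_ge0.
have := pow_kernel_ge0 z n.+1 (fun i => (c i)%:C) N0.
rewrite lecE => /andP[_]; rewrite raddf_sum /=; congr (_ <= _).
apply: eq_bigr => i _; rewrite raddf_sum; apply: eq_bigr => j _.
have ReZ d v : Re (d%:C * v) = d * Re v by case: v => p q /=; rewrite mul0r subr0.
have -> : Num.conj (c j)%:C = (c j)%:C by apply/eqP; rewrite eq_complex /= oppr0 !eqxx.
rewrite -rmorphM [LHS]ReZ; congr (_ * Re ((1 + _) ^+ _)).
by rewrite /u [RHS]mulrA -(rmorph_nat (real_complex R)) -fmorphV -rmorphM [X in X%:C * _ = _]mulrC.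
Qed.

End GaussianKernel.

(** * Gaussian sums over the integers *)

(** The index shift is that of [sqsum], which makes a square sum an iterated [zsum] by
    conversion. *)
Definition zsum (V : nmodType) (N : nat) (F : int -> V) : V :=
  \sum_(i < N.*2.+1) F (i%:Z - N%:Z).

Section SymmetricSums.
Variable V : nmodType.
Implicit Types (F G : int -> V) (N : nat).

Lemma zsum0 F : zsum 0 F = F 0.
Proof. by rewrite /zsum big_ord_recl big_ord0 addr0. Qed.

Lemma zsumS N F : zsum N.+1 F = zsum N F + (F N.+1%:Z + F (- N.+1%:Z)).
Proof.
rewrite /zsum doubleS big_ord_recl big_ord_recr /= addrCA; congr (_ + _).
  by apply: eq_bigr => i _; congr F; rewrite /bump; lia.
by rewrite addrC; congr (F _ + F _); rewrite /bump; lia.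
Qed.

Lemma eq_zsum N F G : (forall m, F m = G m) -> zsum N F = zsum N G.
Proof. by move=> FG; apply: eq_bigr => i _. Qed.

Lemma zsumD N F G : zsum N (fun m => F m + G m) = zsum N F + zsum N G.
Proof. exact: big_split. Qed.

Lemma zsumN N F : zsum N (fun m => F (- m)) = zsum N F.
Proof.
elim: N => [|N IH]; first by rewrite !zsum0 oppr0.
by rewrite !zsumS IH opprK [F _ + _]addrC.
Qed.

(** The even integers of absolute value at most [2 N] are the doubles of those of absolute value at
    most [N]; this is why partial sums are later taken at [N.*2]. *)
Lemma zsum_even N F :
  zsum N.*2 (fun m => if odd `|m| then 0 else F m) = zsum N (fun m => F (2 * m)).
Proof.
elim: N => [|N IH]; first by rewrite !zsum0 mulr0.
rewrite doubleS !zsumS IH -!addrA; congr (_ + _).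
rewrite !abszN !absz_nat /= odd_double /= !add0r.
by congr (F _ + F _); lia.
Qed.

End SymmetricSums.

Section SymmetricSumsReal.
Variable R : realType.
Implicit Types (f g : int -> R) (N : nat).

Lemma zsumM N c f : zsum N (fun m => c * f m) = c * zsum N f.
Proof. by rewrite /zsum mulr_sumr. Qed.

Lemma ler_zsum N f g : (forall m, f m <= g m) -> zsum N f <= zsum N g.
Proof. by move=> fg; apply: ler_sum => i _. Qed.

Lemma zsum_nondecreasing f : (forall m, 0 <= f m) ->
  nondecreasing_seq (fun N => zsum N f).
Proof.
by move=> f0; apply/nondecreasing_seqP => N; rewrite zsumS lerDl addr_ge0.
Qed.

Lemma zsum_geometric N (r : R) :
  zsum N (fun m => r ^+ `|m|%N) * (1 - r) = 1 + r - 2 * r ^+ N.+1.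
Proof.
elim: N => [|N IH]; first by rewrite zsum0 expr0; ring.
rewrite zsumS mulrDl IH abszN absz_nat !exprS; ring.
Qed.

Lemma zsum_cvg f (r : R) : 0 <= r < 1 ->
  (forall m, 0 <= f m <= r ^+ `|m|%N) -> cvgn (fun N => zsum N f).
Proof.
move=> /andP[r0 r1] fr; apply: nondecreasing_is_cvgn.
  by apply: zsum_nondecreasing => m; case/andP: (fr m).
exists ((1 + r) / (1 - r)) => _ [N _ <-].
apply: le_trans (ler_zsum _ (fun m => proj2 (andP (fr m)))) _.
rewrite ler_pdivlMr ?subr_gt0 // zsum_geometric gerBl mulr_ge0 //.
exact: exprn_ge0.
Qed.

(* Summing over the square [0, M)^2 along hooks. *)
Lemma sum_differences M f :
  \sum_(i < M) \sum_(j < M) f (i%:Z - j%:Z) = \sum_(k < M) zsum k f.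
Proof.
elim: M => [|M IH]; first by rewrite !big_ord0.
rewrite !big_ord_recr /= -IH.
under eq_bigr do rewrite big_ord_recr /=.
rewrite big_split /= -!addrA; congr (_ + _).
(* What remains is the hook formed by the last row and column; its differences run once through
   [-M, ..., M]. *)
rewrite subrr; elim: M {IH} => [|M IH]; first by rewrite !big_ord0 zsum0 !add0r.
rewrite zsumS -IH !big_ord_recl /= subr0 sub0r.
rewrite (eq_bigr (fun i : 'I_M => f (i%:Z - M%:Z))); last first.
  by move=> i _; congr f; rewrite /bump; lia.
rewrite [X in _ + (_ + X + _)](eq_bigr (fun i : 'I_M => f (M%:Z - i%:Z))); last first.
  by move=> i _; congr f; rewrite /bump; lia.
ring.
Qed.

End SymmetricSumsReal.

(** * Theta sums and the limit of the scalar part *)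

Section Theta.
Variable R : realType.
Implicit Types (m n : int) (N M : nat).

(** In the introductory notation, [al = pi / 2] gives [q^(m^2)] and [al = pi / 2 * (rho - 1)] gives
    [r^(m^2)]. *)
Definition gauss (al : R) m : R := expR (- al * m%:~R ^+ 2).

Lemma gauss_gt0 al m : 0 < gauss al m.
Proof. exact: expR_gt0. Qed.

Lemma gauss_ge0 al m : 0 <= gauss al m.
Proof. exact: expR_ge0. Qed.

Lemma gauss0 al : gauss al 0 = 1.
Proof. by rewrite /gauss expr0n mulr0 expR0. Qed.

Lemma gaussN al m : gauss al (- m) = gauss al m.
Proof. by rewrite /gauss rmorphN sqrrN. Qed.

Lemma gauss_double al m : gauss al (2 * m) = gauss al m ^+ 4.
Proof. by rewrite /gauss -expRM_natl rmorphM; congr expR; ring. Qed.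

Lemma gaussD al be m : gauss (al + be) m = gauss al m * gauss be m.
Proof. by rewrite /gauss -expRD; congr expR; ring. Qed.

Lemma gauss_le al m : 0 <= al -> gauss al m <= expR (- al) ^+ `|m|%N.
Proof.
move=> al0; rewrite -expRM_natl ler_expR mulrN mulNr lerN2 mulrC ler_wpM2l //.
rewrite -rmorphXn /= pmulrn ler_int; nia.
Qed.

Lemma gauss_cvg al (f : int -> R) : 0 < al ->
  (forall m, 0 <= f m <= gauss al m) -> cvgn (fun N => zsum N f).
Proof.
move=> al0 fg; apply: (@zsum_cvg _ _ (expR (- al))).
  by rewrite expR_ge0 expR_lt1 oppr_lt0.
move=> m; have /andP[-> /le_trans -> //] := fg m.
exact: gauss_le (ltW al0).
Qed.

Definition even_part (f : int -> R) m : R := if odd `|m| then 0 else f m.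

(* The sign [(-1)^(mn+m+n)]. *)
Definition chi m n : R := if odd `|m| || odd `|n| then -1 else 1.

(** [chi] is twice the indicator of the pairs with both entries even, minus 1, and each of these two
    terms factors over [m] and [n]. *)
Lemma zsum_chi N (f : int -> R) :
  zsum N (fun m => zsum N (fun n => chi m n * (f m * f n)))
  = 2 * zsum N (even_part f) ^+ 2 - zsum N f ^+ 2.
Proof.
have E (h : int -> R) : zsum N (fun m => zsum N (fun n => h m * h n)) = zsum N h ^+ 2.
  rewrite (@eq_zsum _ _ _ (fun m => zsum N h * h m)); first by rewrite zsumM.
  by move=> m; rewrite zsumM mulrC.
rewrite -!E -zsumM -mulN1r -zsumM -zsumD; apply: eq_zsum => m.
rewrite -!zsumM -zsumD; apply: eq_zsum => n.
by rewrite /chi /even_part; case: (odd _); case: (odd _) => /=; ring.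
Qed.

Lemma cos_pi_nat (k : nat) : cos (pi * k%:R) = (-1) ^+ k :> R /\ sin (pi * k%:R) = 0 :> R.
Proof.
elim: k => [|k [IHc IHs]]; first by rewrite mulr0 cos0 sin0.
rewrite -natr1 mulrDr mulr1 cosDpi sinDpi IHc IHs oppr0; split=> //.
by rewrite exprS mulN1r.
Qed.

(* Positive definiteness of the Gaussian kernel, tested on the sign [chi] over the square [0, M)^2. *)
Lemma theta_square_partial M (G := gauss (pi / 2)) :
  (\sum_(k < M) zsum k G) ^+ 2 <= 2 * (\sum_(k < M) zsum k (even_part G)) ^+ 2.
Proof.
rewrite -subr_ge0 -!sum_differences.
pose c (p : 'I_M * 'I_M) : R := chi p.1 p.2 * (G p.1 * G p.2).
have := gaussian_kernel_ge0 c (fun p => (p.1 : nat)%:R) (fun p => (p.2 : nat)%:R) (pi_ge0 R).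
congr (_ <= _).
transitivity (\sum_(p : 'I_M * 'I_M) \sum_(p' : 'I_M * 'I_M)
   (2 * (even_part G (p.1%:Z - p'.1%:Z) * even_part G (p.2%:Z - p'.2%:Z))
    - G (p.1%:Z - p'.1%:Z) * G (p.2%:Z - p'.2%:Z))).
  apply: eq_bigr => -[m n] _; apply: eq_bigr => -[m' n'] _ /=.
  (* Expanding [(i - j)^2] leaves the cross term [pi i j]; the diagonal factors are absorbed into
     [c]. *)
  have GB (i j : nat) : G (i%:Z - j%:Z) = G i * G j * expR (pi * (i%:R * j%:R)).
    by rewrite /G /gauss -!expRD rmorphB /=; congr expR; rewrite -!pmulrn; field.
  have -> : cos (pi * (n%:R * m'%:R - m%:R * n'%:R)) =
      (-1) ^+ (odd (n * m') (+) odd (m * n')) :> R.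
    rewrite mulrBr cosB -!natrM (cos_pi_nat (n * m')).1 (cos_pi_nat (m * n')).1.
    by rewrite (cos_pi_nat (n * m')).2 mul0r addr0 signr_addb !signr_odd.
  have o (i j : nat) : odd `|i%:Z - j%:Z|%N = odd i (+) odd j by lia.
  (* The exponent [mn + m + n] of [chi] is quadratic mod 2 with polar form [n m' + m n']. Hence
     [chi p chi p'] times the cosine is [chi (p - p')]. *)
  rewrite /c /= /even_part !GB !o mulrDr expRD !oddM /chi !absz_nat.
  by case: (odd m); case: (odd n); case: (odd m'); case: (odd n') => /=; ring.
have E (h : int -> R) : \sum_(p : 'I_M * 'I_M) \sum_(p' : 'I_M * 'I_M)
    h (p.1%:Z - p'.1%:Z) * h (p.2%:Z - p'.2%:Z)
  = (\sum_(i < M) \sum_(j < M) h (i%:Z - j%:Z)) ^+ 2.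
  rewrite expr2 mulr_suml -(pair_bigA _ (fun m n : 'I_M => \sum_(p' : 'I_M * 'I_M)
    h (m%:Z - p'.1%:Z) * h (n%:Z - p'.2%:Z))) /=.
  apply: eq_bigr => m _; rewrite mulr_sumr; apply: eq_bigr => n _.
  rewrite mulr_suml -(pair_bigA _ (fun m' n' : 'I_M => 
    h (m%:Z - m'%:Z) * h (n%:Z - n'%:Z))) /=.
  by apply: eq_bigr => m' _; rewrite mulr_sumr.
rewrite -!E mulr_sumr -sumrB; apply: eq_bigr => p _.
by rewrite mulr_sumr -sumrB.
Qed.

(** Only the limit of the partial sums is shown to be nonnegative, hence the error [e]. *)
Lemma chi_sum_limit (e : R) : 0 < e -> exists N0, forall N, (N0 <= N)%N ->
  - e <= zsum N (fun m => zsum N (fun n => chi m n * (gauss (pi / 2) m * gauss (pi / 2) n))).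
Proof.
move=> e0; pose G := gauss (pi / 2); have p0 : 0 < pi / 2 :> R by rewrite divr_gt0 ?pi_gt0.
have ca : cvgn (fun N => zsum N G).
  by apply: (gauss_cvg p0) => m; rewrite gauss_ge0 lexx.
have cb : cvgn (fun N => zsum N (even_part G)).
  by apply: (gauss_cvg p0) => m; rewrite /even_part; case: ifP; rewrite gauss_ge0 ?lexx.
set a : R := limn _ in ca; set b : R := limn _ in cb.
have sq (u : R^nat) (l : R) : (u @ \oo --> l -> u n ^+ 2 @[n --> \oo] --> l ^+ 2)%classic.
  by move=> ul; rewrite expr2; under eq_fun do rewrite expr2; exact: cvgM.
have comb (u v : R^nat) (k l : R) : (u @ \oo --> k -> v @ \oo --> l ->
    2 * u n ^+ 2 - v n ^+ 2 @[n --> \oo] --> 2 * k ^+ 2 - l ^+ 2)%classic.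
  by move=> uk vl; apply: cvgB; [apply: cvgMl_tmp|]; exact: sq.
have lim0 : 0 <= 2 * b ^+ 2 - a ^+ 2.
  (* [theta_square_partial] speaks of sums of partial sums. Divided by their number these are Cesaro
     means, which have the same limits [b] and [a]. *)
  apply: (cvgr_to_ge (comb _ _ _ _ (cesaro cb) (cesaro ca))).
  apply: nearW => n; rewrite /arithmetic_mean /= !exprMn mulrCA -mulrBr.
  apply: mulr_ge0; first by rewrite sqr_ge0.
  by rewrite subr_ge0 /series /= !big_mkord; exact: theta_square_partial.
have [//|N0 _ H] := cvgr_ge _ (comb _ _ _ _ cb ca) (- e).
  by apply: lt_le_trans lim0; rewrite oppr_lt0.
by exists N0 => N NN; rewrite zsum_chi; exact: H.
Qed.

End Theta.

(** * Sums over squares in the integer lattice *)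

Section DoubleSums.
Variables (R : realType) (A : algType R[i]) (S : cstar_struct A).
Implicit Types (F G : int -> int -> A) (N M : nat).

Lemma sqsumE F N : sqsum F N = zsum N (fun m => zsum N (F m)).
Proof. by []. Qed.

Lemma eq_sqsum F G N : (forall m n, F m n = G m n) -> sqsum F N = sqsum G N.
Proof. by move=> FG; rewrite !sqsumE; apply: eq_zsum => m; apply: eq_zsum. Qed.

Lemma sqsumD F G N : sqsum (fun m n => F m n + G m n) N = sqsum F N + sqsum G N.
Proof. by rewrite !sqsumE -zsumD; apply: eq_zsum => m; rewrite zsumD. Qed.

Lemma sqsumNN F N : sqsum (fun m n => F (- m) (- n)) N = sqsum F N.
Proof.
rewrite !sqsumE -[RHS]zsumN; apply: eq_zsum => m.
by rewrite (zsumN _ (F (- m))).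
Qed.

Lemma sqsumZ c F N : sqsum (fun m n => c *: F m n) N = c *: sqsum F N.
Proof. by rewrite /sqsum scaler_sumr; apply: eq_bigr => i _; rewrite scaler_sumr. Qed.

Lemma sqsum_scale1 (f : int -> int -> R) N :
  sqsum (fun m n => (f m n)%:C *: (1 : A)) N = (zsum N (fun m => zsum N (f m)))%:C *: 1.
Proof.
rewrite /sqsum /zsum raddf_sum scaler_suml; apply: eq_bigr => i _.
by rewrite raddf_sum scaler_suml.
Qed.

Lemma star_sqsum F N : star S (sqsum F N) = sqsum (fun m n => star S (F m n)) N.
Proof. by rewrite /sqsum star_sum; apply: eq_bigr => i _; rewrite star_sum. Qed.

(** The new frame has two lines [m = N+1] and [m = -(N+1)] without end points, and two full lines
    [n = N+1] and [n = -(N+1)], so that each corner is counted once. *)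
Lemma sqsumS F N : sqsum F N.+1 = sqsum F N +
  ((zsum N (F N.+1%:Z) + zsum N (F (- N.+1%:Z)))
   + zsum N.+1 (fun m => F m N.+1%:Z + F m (- N.+1%:Z))).
Proof.
rewrite !sqsumE (eq_zsum _ (fun m => zsumS N (F m))) zsumD zsumS.
by rewrite !addrA.
Qed.

Lemma sqsum_even F N : sqsum (fun m n => if odd `|m| || odd `|n| then 0 else F m n) N.*2
  = sqsum (fun m n => F (2 * m) (2 * n)) N.
Proof.
rewrite !sqsumE -(zsum_even N (fun m => zsum N (fun n => F m (2 * n)))).
apply: eq_zsum => m; case: ifP => /= om; last exact: zsum_even.
by rewrite /zsum big1.
Qed.

Lemma nrm_zsum N (f : int -> A) : nrm S (zsum N f) <= zsum N (fun m => nrm S (f m)).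
Proof. exact: nrm_sum. Qed.

Lemma sqsum_cvg F (f : int -> R) : (forall m, 0 <= f m) ->
  (forall m n, nrm S (F m n) <= f m * f n) -> cvgn (fun N => zsum N f) ->
  exists x, cvgA S (sqsum F) x.
Proof.
move=> f0 Ff cf; pose z N := zsum N f.
(* The frame is dominated by the same frame of the product [f m * f n], whose square sums are
   [z N ^ 2]; so the increments telescope. *)
have step N : nrm S (sqsum F N.+1 - sqsum F N) <= z N.+1 ^+ 2 - z N ^+ 2.
  rewrite sqsumS [X in nrm S X]addrC addKr; apply: le_trans (nrmD _ _ _) _.
  have row m : nrm S (zsum N (F m)) <= f m * z N.
    by apply: le_trans (nrm_zsum _ _) _; rewrite -zsumM; exact: ler_zsum.
  have col : nrm S (zsum N.+1 (fun m => F m N.+1%:Z + F m (- N.+1%:Z)))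
      <= (f N.+1%:Z + f (- N.+1%:Z)) * z N.+1.
    apply: le_trans (nrm_zsum _ _) _; rewrite -zsumM; apply: ler_zsum => m.
    by apply: le_trans (nrmD _ _ _) _; rewrite mulrDl ![_ * f m]mulrC lerD.
  apply: le_trans (lerD (le_trans (nrmD _ _ _) (lerD (row _) (row _))) col) _.
  by rewrite /z zsumS le_eqVlt; apply/orP; left; apply/eqP; ring.
have tele N d : nrm S (sqsum F (N + d) - sqsum F N) <= z (N + d)%N ^+ 2 - z N ^+ 2.
  elim: d => [|d IH]; first by rewrite addn0 !subrr nrm0.
  rewrite addnS -(subrK (sqsum F (N + d)) (sqsum F (N + d).+1)) -addrA.
  apply: le_trans (nrmD _ _ _) _; apply: le_trans (lerD (step _) IH) _.
  by rewrite addrA subrK.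
apply: nrm_complete => e e0; set l : R := limn _ in cf.
have cz : (z n ^+ 2 @[n --> \oo] --> l ^+ 2)%classic.
  by rewrite expr2; under eq_fun do rewrite expr2; exact: cvgM.
have e20 : 0 < e / 2 by rewrite divr_gt0.
move: cz => /cvgrPdist_lt /(_ _ e20) [N0 _ HN]; exists N0 => m n.
wlog nm : m n / (n <= m)%N.
  move=> W Nm Nn; case: (leqP n m) => [H|/ltnW H]; first exact: W.
  by rewrite nrm_sub; exact: W.
move=> Nm Nn; have := tele n (m - n)%N; rewrite subnKC // => /le_lt_trans; apply.
have := HN m Nm; have := HN n Nn; rewrite /= !ltr_norml => /andP[? ?] /andP[? ?].
lra.
Qed.

Lemma lower_bound_zsum N (f : int -> A) (c : int -> R) :
  (forall m, lower_bound S (f m) (c m)) -> lower_bound S (zsum N f) (zsum N c).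
Proof. by move=> H; rewrite /zsum; apply: lower_bound_sum => i _; exact: H. Qed.

Lemma lower_bound_sqsum F (c : int -> int -> R) N :
  (forall m n, lower_bound S (F m n) (c m n)) ->
  lower_bound S (sqsum F N) (zsum N (fun m => zsum N (c m))).
Proof. by move=> H; rewrite sqsumE; apply: lower_bound_zsum => m; apply: lower_bound_zsum. Qed.

Lemma lower_bound_sqsumB F N M : (N <= M)%N ->
  (forall m n, lower_bound S (F m n) 0) -> lower_bound S (sqsum F M - sqsum F N) 0.
Proof.
move=> NM H; have z0 K : zsum K (fun=> 0) = 0 :> R by rewrite /zsum big1.
have lz K f : (forall m, lower_bound S (f m) 0) -> lower_bound S (zsum K f) 0.
  by move=> Hf; rewrite -(z0 K); exact: lower_bound_zsum.
have lD x y : lower_bound S x 0 -> lower_bound S y 0 -> lower_bound S (x + y) 0.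
  by move=> hx hy; rewrite -[0]addr0; exact: lower_boundD.
elim: M NM => [|M IH].
  by rewrite leqn0 => /eqP ->; rewrite subrr; exact: lower_bound0.
rewrite leq_eqVlt => /orP[/eqP ->|].
  by rewrite subrr; exact: lower_bound0.
rewrite ltnS => NM; rewrite sqsumS [X in lower_bound S (X - _)]addrC -[X in lower_bound S X]addrA.
apply: (lD); last exact: IH.
by apply: (lD); [apply: (lD); exact: (lz) | apply: lz => m; exact: lD].
Qed.

End DoubleSums.

(** * Positivity of twisted Gaussian sums *)

Section TwistedGaussian.
Variables (R : realType) (A : algType R[i]) (S : cstar_struct A).
Variables (be : R) (w : int -> int -> A).
Hypotheses (be0 : 0 < be)
  (w_unitary : forall m n, unitary S (w m n))
  (w_star : forall m n, star S (w m n) = w (- m) (- n))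
  (w_double : forall m n, w (2 * m) (2 * n) = w m n ^+ 2).
Implicit Types (m n : int) (N : nat).

(** [g] is [q^|l|^2], [r] is [r^|l|^2] with [r = exp (- be)], and [a] is [Re (w l)], all at
    [l = (m, n)]. *)
Let g m n : R := gauss (pi / 2) m * gauss (pi / 2) n.
Let r m n : R := gauss be m * gauss be n.
Let a m n : A := (2^-1)%:C *: (w m n + star S (w m n)).
Let D m n : A := 1 - (r m n)%:C *: a m n.
Let F m n : A := (chi R m n * g m n * r m n)%:C *: w m n.

Let p0 : 0 < pi / 2 :> R.
Proof. by rewrite divr_gt0 ?pi_gt0. Qed.

Let r_ge0 m n : 0 <= r m n. Proof. by rewrite mulr_ge0 ?gauss_ge0. Qed.
Let g_ge0 m n : 0 <= g m n. Proof. by rewrite mulr_ge0 ?gauss_ge0. Qed.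
Let r_double m n : r (2 * m) (2 * n) = r m n ^+ 4.
Proof. by rewrite /r !gauss_double exprMn. Qed.
Let g_double m n : g (2 * m) (2 * n) = g m n ^+ 4.
Proof. by rewrite /g !gauss_double exprMn. Qed.

Let gauss_le1 al m : 0 <= al -> gauss al m <= 1 :> R.
Proof. by move=> al0; rewrite /gauss expR_le1 mulNr oppr_le0 mulr_ge0 ?sqr_ge0. Qed.

Let r_le1 m n : r m n <= 1.
Proof. by rewrite mulr_ile1 ?gauss_ge0 ?gauss_le1 // ltW. Qed.

(** Since [pi >= 2], [exp (pi / 6) >= 1 + 1/3]; the cube of this gives [exp (pi / 2) >= 64 / 27]. *)
Let q0_le : expR (- (pi / 2)) <= 27 / 64 :> R.
Proof.
have h : 4 / 3 <= expR (pi / 6) :> R.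
  apply: le_trans (expR_ge1Dx _); have := pi_ge2 R; lra.
have : (4 / 3) ^+ 3 <= expR (pi / 2) :> R.
  have -> : pi / 2 = 3%:R * (pi / 6) :> R by field.
  rewrite expRM_natl ler_pXn2r ?nnegrE ?expR_ge0 //; lra.
have := expRxMexpNx_1 (pi / 2 : R); have := expR_gt0 (- (pi / 2) : R).
move: (expR _) (expR _) => x y; nra.
Qed.

Let g_le m n : (m != 0) || (n != 0) -> g m n <= 27 / 64.
Proof.
have H k : k != 0 -> gauss (pi / 2) k <= 27 / 64 :> R.
  move=> k0; apply: le_trans q0_le; apply: le_trans (gauss_le _ (ltW p0)) _.
  rewrite -[leRHS]expr1; apply: ler_wiXn2l; rewrite ?expR_ge0 ?expR_le1 ?oppr_le0 ?ltW //.
  lia.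
have L k := gauss_le1 k (ltW p0); have P k := @gauss_ge0 R (pi / 2) k.
rewrite /g => /orP[/H h|/H h].
  by apply: le_trans h; rewrite ler_piMr.
by apply: le_trans h; rewrite ler_piMl.
Qed.

(* [w 0 0] is a unitary equal to its own square. *)
Let w0 : w 0 0 = 1.
Proof.
have [u1 u2] := w_unitary 0 0; have := w_double 0 0; rewrite !mulr0 => e.
by rewrite -[LHS]mul1r -u1 -mulrA -expr2 -e.
Qed.

Let D0 : D 0 0 = 0.
Proof. by rewrite /D /r /a w0 star1 half_double !gauss0 mulr1 scale1r subrr. Qed.

Let a_nrm m n : nrm S (a m n) <= 1.
Proof.
rewrite /a nrmZR ger0_norm ?invr_ge0 // mulrC ler_pdivrMr // mul1r.
by apply: le_trans (nrmD _ _ _) _; rewrite nrm_star (nrm_unitary (w_unitary m n)).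
Qed.

Let a_self m n : selfadjoint S (a m n).
Proof. by rewrite /selfadjoint /a starZR starD starK addrC. Qed.

(** The identity [cos 2t = 2 cos^2 t - 1] for the real part of a unitary. *)
Let a_double m n : a (2 * m) (2 * n) = 2%:C *: a m n ^+ 2 - 1.
Proof.
have [u1 u2] := w_unitary m n; rewrite /a w_double star_exp.
set u := w m n in u1 u2 *; set v := star S u in u1 u2 *.
rewrite exprZn [(u + v) ^+ 2]expr2 mulrDl !mulrDr u1 u2 -!expr2.
have -> : u ^+ 2 + 1 + (1 + v ^+ 2) = (u ^+ 2 + v ^+ 2) + (1 + 1).
  by rewrite -!addrA; congr (_ + _); rewrite addrA addrC.
rewrite scalerA -rmorphXn -rmorphM (_ : 2 * 2^-1 ^+ 2 = 2^-1 :> R); last by field.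
by rewrite [in RHS]scalerDr half_double addrK.
Qed.

Let lower_bound_scaled_a k m n : lower_bound S (k%:C *: a m n) (- `|k|).
Proof.
apply: lower_bound_mono (lower_bound_nrm S _).
by rewrite lerN2 nrmZR ler_piMr.
Qed.

Let lower_bound_D m n : lower_bound S (D m n) (1 - r m n).
Proof.
rewrite /D; apply: lower_boundD.
  by have := lower_boundR S 1; rewrite scale1r.
rewrite -scaleNr -rmorphN; apply: lower_bound_mono (lower_bound_scaled_a _ _ _).
by rewrite normrN ger0_norm.
Qed.

(** With [t = r m n], one has [r (2 l) = t^4]; expanding around [x = 1] leaves a square, a scalar
    and a multiple of [x], and [|x| <= 1]. *)
Let lower_bound_D_double m n : lower_bound S (4%:C *: D m n - D (2 * m) (2 * n)) 0.
Proof.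
rewrite /D a_double r_double; set x := a m n; set t := r m n.
have -> : 4%:C *: (1 - t%:C *: x) - (1 - (t ^+ 4)%:C *: (2%:C *: x ^+ 2 - 1))
  = (3 - 3 * t ^+ 4)%:C *: 1 + (- (4 * t - 4 * t ^+ 4))%:C *: x
    + (2 * t ^+ 4)%:C *: (x - 1) ^+ 2.
  (* Only [x] and scalars occur, so the identity is proved for polynomials, where multiplication
     commutes, and then evaluated at [x]. *)
  pose c k : {poly R[i]} := (k%:C)%:P.
  pose phi := horner_alg x.
  have phiZ k p : phi (c k * p) = k%:C *: phi p.
    by rewrite /phi rmorphM /= horner_algC mulr_algl.
  have phiB p q : phi (p - q) = phi p - phi q by exact: rmorphB.
  have phiD p q : phi (p + q) = phi p + phi q by exact: rmorphD.
  have phiX p : phi (p ^+ 2) = phi p ^+ 2 by exact: rmorphXn.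
  have [phi1 phix] : phi 1 = 1 /\ phi 'X = x by rewrite /phi rmorph1 horner_algX.
  transitivity (phi (c 4 * (1 - c t * 'X) - (1 - c (t ^+ 4) * (c 2 * 'X ^+ 2 - 1)))).
    by rewrite !(phiB, phiZ, phiX, phi1, phix).
  transitivity (phi (c (3 - 3 * t ^+ 4) * 1 + c (- (4 * t - 4 * t ^+ 4)) * 'X
    + c (2 * t ^+ 4) * ('X - 1) ^+ 2)); last first.
    by rewrite 2!phiD !phiZ phiX phiB phi1 phix.
  congr phi.
  by rewrite /c !(rmorphB, rmorphN, rmorphM, rmorphXn, rmorph_nat); ring.
have t0 : 0 <= t := r_ge0 m n; have t1 : t <= 1 := r_le1 m n.
have t4 : t ^+ 4 <= t by rewrite exprS ler_piMr // exprn_ile1.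
(* The three bounds add up to [3 - 4 t + t^4 = (1 - t)^2 (3 + 2 t + t^2)]. *)
apply: (@lower_bound_mono _ _ _ _ ((3 - 3 * t ^+ 4) - (4 * t - 4 * t ^+ 4) + 2 * t ^+ 4 * 0)).
  rewrite mulr0 addr0; have : 0 <= (1 - t) ^+ 2 * (3 + 2 * t + t ^+ 2).
    by apply: mulr_ge0; [exact: sqr_ge0 | have := sqr_ge0 t; lra].
  lra.
apply: lower_boundD; last first.
  apply: lower_boundZ; first by rewrite mulr_ge0 ?exprn_ge0.
  apply: lower_bound_sqr.
  by rewrite /selfadjoint starD starN star1 a_self.
apply: lower_boundD; first exact: lower_boundR.
apply: lower_bound_mono (lower_bound_scaled_a _ _ _).
by rewrite normrN ger0_norm // -mulrBr mulr_ge0 // subr_ge0.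
Qed.

(* [al] is what is left of the coefficient [- chi g] of [D] once [3/2 g^4 (4 D l - D (2 l))] has been split off
   for every [l]; recall that [g (2 l) = g l ^ 4]. *)
Let ev m n : R := if odd `|m| || odd `|n| then 0 else 1.
Let al m n : R := - chi R m n * g m n - 6 * g m n ^+ 4 + 3 / 2 * ev m n * g m n.

(** [al] is [g - 6 g^4] if [m] or [n] is odd, and [g / 2 - 6 g^4] otherwise. In the second, worse
    case [6 (27/64)^3 <= 1/2 - 1/24] suffices. *)
Let al_ge m n : (m != 0) || (n != 0) -> g m n / 24 <= al m n.
Proof.
move=> /g_le gle; have g0 := g_ge0 m n.
have g3 : 6 * g m n ^+ 3 <= 2^-1 - 24^-1.
  have : g m n ^+ 3 <= (27 / 64) ^+ 3 by rewrite ler_pXn2r // nnegrE; lra.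
  lra.
have g4 : 6 * g m n ^+ 4 <= g m n * (2^-1 - 24^-1).
  by rewrite exprS mulrCA ler_wpM2l.
by rewrite /al /ev /chi; case: ifP => _; lra.
Qed.

(** The terms [3/2 g^4 (4 D l - D (2 l))] with [l] in the square of radius [N] use [D (2 l)] up to
    radius [2 N]. The difference of the two sums of [6 g^4 D] corrects for this mismatch. *)
Let sqsum_decomp N : sqsum F N.*2 =
  (zsum N.*2 (fun m => zsum N.*2 (fun n => chi R m n * g m n)))%:C *: 1
  + sqsum (fun m n => (al m n)%:C *: D m n) N.*2
  + (sqsum (fun m n => (6 * g m n ^+ 4)%:C *: D m n) N.*2
     - sqsum (fun m n => (6 * g m n ^+ 4)%:C *: D m n) N)
  + sqsum (fun m n => (3 / 2 * g m n ^+ 4)%:C *: (4%:C *: D m n - D (2 * m) (2 * n))) N.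
Proof.
(* Averaging over [l] and [-l] replaces each [w l] by its real part, since the coefficients are
   even. *)
have FE : sqsum F N.*2 = sqsum (fun m n => (chi R m n * g m n * r m n)%:C *: a m n) N.*2.
  rewrite -[LHS](half_double (sqsum F N.*2)) -{2}(sqsumNN F) -sqsumD -sqsumZ.
  apply: eq_sqsum => m n; rewrite /F /a w_star.
  rewrite (_ : chi R (- m) (- n) * _ * _ = chi R m n * g m n * r m n).
    by rewrite -scalerDr !scalerA mulrC.
  by rewrite /chi /g /r !abszN !gaussN.
rewrite FE -sqsum_scale1 -!addrA.
(* As [g l ^ 4 = g (2 l)], the terms in [D (2 l)] are reindexed by the even pairs of the larger
   square. *)
have -> : sqsum (fun m n => (3 / 2 * g m n ^+ 4)%:C *: (4%:C *: D m n - D (2 * m) (2 * n))) N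
  = sqsum (fun m n => (6 * g m n ^+ 4)%:C *: D m n) N
    + sqsum (fun m n => if odd `|m| || odd `|n| then 0
        else (- (3 / 2 * g m n))%:C *: D m n) N.*2.
  rewrite sqsum_even -sqsumD; apply: eq_sqsum => m n.
  rewrite scalerBr scalerA -rmorphM g_double rmorphN scaleNr; congr (_%:C *: _ - _).
  by field.
rewrite addKr -!sqsumD; apply: eq_sqsum => m n.
have -> : (if odd `|m| || odd `|n| then 0 else (- (3 / 2 * g m n))%:C *: D m n)
   = (- (3 / 2 * ev m n * g m n))%:C *: D m n.
  by rewrite /ev; case: ifP => _; rewrite ?mulr0 ?mul0r ?oppr0 ?scale0r ?mulr1.
rewrite -!scalerDl -!rmorphD.
have -> : al m n + (6 * g m n ^+ 4 - 3 / 2 * ev m n * g m n) = - (chi R m n * g m n).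
  by rewrite /al; ring.
by rewrite rmorphN scaleNr /D scalerBr opprB addrCA subrr addr0 [RHS]scalerA -rmorphM.
Qed.

(** The contribution guaranteed by the term [l = (1, 0)]; it does not depend on [N]. *)
Let del : R := g 1 0 / 24 * (1 - r 1 0).

Let del_gt0 : 0 < del.
Proof.
rewrite /del mulr_gt0 ?divr_gt0 ?mulr_gt0 ?gauss_gt0 //.
by rewrite subr_gt0 /r gauss0 mulr1 /gauss expR_lt1 expr1n mulr1 oppr_lt0.
Qed.

(** The four summands of [sqsum_decomp] contribute the scalar sum, [del], 0 and 0; [0 < N] puts
    [(1, 0)] into the square. *)
Let lower_bound_partial N : (0 < N)%N -> lower_bound S (sqsum F N.*2)
  (zsum N.*2 (fun m => zsum N.*2 (fun n => chi R m n * g m n)) + del).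
Proof.
move=> N0; rewrite sqsum_decomp.
have D_ge0 m n : 0 <= 1 - r m n by rewrite subr_ge0.
rewrite -[X in lower_bound _ _ X]addr0; apply: lower_boundD; last first.
  have -> : 0 = zsum N (fun=> zsum N (fun=> 0)) :> R.
    by rewrite /zsum big1 // => i _; rewrite big1.
  apply: lower_bound_sqsum => m n; rewrite -[X in lower_bound _ _ X](mulr0 (3 / 2 * g m n ^+ 4)).
  by apply: lower_boundZ (lower_bound_D_double m n); rewrite mulr_ge0 ?exprn_ge0 ?divr_ge0.
rewrite -[X in lower_bound _ _ X]addr0; apply: lower_boundD; last first.
  apply: lower_bound_sqsumB => [|m n]; first by rewrite -addnn leq_addr.
  apply: (@lower_bound_mono _ _ _ _ (6 * g m n ^+ 4 * (1 - r m n))).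
    exact: (mulr_ge0 (mulr_ge0 (ler0n _ 6) (exprn_ge0 4 (g_ge0 m n))) (D_ge0 m n)).
  by apply: lower_boundZ (lower_bound_D m n); rewrite mulr_ge0 ?exprn_ge0.
apply: lower_boundD; first exact: lower_boundR.
(* At the origin [al 0 0 = -11/2] is negative, but [D 0 0 = 0], so that term is harmless. *)
pose c m n := if (m != 0) || (n != 0) then al m n * (1 - r m n) else 0.
have al_ge0 m n : (m != 0) || (n != 0) -> 0 <= al m n.
  by move=> /al_ge; apply: le_trans; rewrite divr_ge0.
have c_ge0 m n : 0 <= c m n by rewrite /c; case: ifP => // /al_ge0 h; rewrite mulr_ge0.
apply: (@lower_bound_mono _ _ _ _ (zsum N.*2 (fun m => zsum N.*2 (c m)))); last first.
  apply: lower_bound_sqsum => m n; rewrite /c; case: ifP => [/al_ge0 h|].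
    by apply: lower_boundZ (lower_bound_D m n).
  by case: eqVneq => //= ->; case: eqVneq => //= -> _; rewrite D0 scaler0; exact: lower_bound0.
have zc_ge0 m : 0 <= zsum N.*2 (c m) by rewrite sumr_ge0.
apply: le_trans (_ : del <= c 1 0) _.
  by rewrite /c /= /del ler_wpM2r // al_ge.
apply: (@le_trans _ _ (zsum N.*2 (c 1))).
  rewrite -(zsum0 (c 1)); exact: (zsum_nondecreasing (c_ge0 1)).
apply: (@le_trans _ _ (zsum 1 (fun m => zsum N.*2 (c m)))).
  by rewrite zsumS zsum0 addrCA lerDl addr_ge0.
by apply: (zsum_nondecreasing zc_ge0); rewrite double_gt0.
Qed.

Lemma twisted_gaussian_positive : exists x : A,
  cvgA S (sqsum F) x /\ positive S x /\ invertible x.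
Proof.
have [x Fx] : exists x, cvgA S (sqsum F) x.
  pose f m : R := gauss (pi / 2 + be) m.
  have pb : 0 < pi / 2 + be by rewrite addr_gt0.
  apply: (@sqsum_cvg _ _ _ _ f).
  - by move=> m; exact: gauss_ge0.
  - move=> m n; rewrite /F nrmZR (nrm_unitary (w_unitary m n)) mulr1.
    rewrite (normrM (chi R m n * g m n)) (normrM (chi R m n)).
    rewrite (ger0_norm (g_ge0 m n)) (ger0_norm (r_ge0 m n)).
    have -> : `|chi R m n| = 1 by rewrite /chi; case: ifP; rewrite ?normrN normr1.
    by rewrite /f !gaussD /g /r mul1r mulrACA.
  - by apply: (gauss_cvg pb) => m; rewrite gauss_ge0 lexx.
exists x; split=> //.
have self : selfadjoint S x.
  have Fs N : star S (sqsum F N) = sqsum F N.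
    rewrite star_sqsum -[RHS]sqsumNN; apply: eq_sqsum => m n.
    by rewrite /F starZR w_star /chi /g /r !abszN !gaussN.
  apply/eqP; rewrite -subr_eq0; apply/eqP/(@nrm_small _ _ S) => e e0.
  have e2 : 0 < e / 2 by rewrite divr_gt0.
  have [N HN] := Fx _ e2; have := HN N (leqnn N) => h.
  rewrite -(subrK (sqsum F N) (star S x)) -addrA.
  apply: le_lt_trans (nrmD _ _ _) _.
  rewrite -{1}Fs -starN -starD nrm_star nrm_sub; lra.
(* Of [del], one quarter pays for the distance from [x] to the partial sum and one for the scalar
   sum; [del / 2] remains. *)
have d4 : 0 < del / 4 by rewrite divr_gt0.
have [N1 H1] := Fx _ d4; have [N2 H2] := chi_sum_limit d4.
pose N := (N1 + N2).+1.
have n1 : (N1 <= N.*2)%N by rewrite /N; lia.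
have n2 : (N2 <= N.*2)%N by rewrite /N; lia.
have d2 : 0 < del / 2 by rewrite divr_gt0.
apply: (lower_bound_positive self d2).
rewrite -(subrK (sqsum F N.*2) x).
apply: (lower_bound_mono _ (lower_boundD (lower_bound_nrm S _) (lower_bound_partial (ltn0Sn _)))).
rewrite nrm_sub; have := H1 _ n1; have := H2 _ n2; rewrite /g -/N; lra.
Qed.

End TwistedGaussian.

(** * Weyl operators of the rotation algebra *)

Section WeylOperators.
Variables (R : realType) (A : algType R[i]) (S : cstar_struct A).
Implicit Types (x y : R) (m n : int).

Lemma eeD x y : ee (x + y) = ee x * ee y.
Proof.
apply/eqP; rewrite eq_complex /= mulrDr cosD sinD.
by apply/andP; split; apply/eqP; ring.
Qed.

Lemma ee0 : ee (0 : R) = 1.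
Proof. by apply/eqP; rewrite eq_complex /= mulr0 cos0 sin0 !eqxx. Qed.

Lemma eeX x k : ee x ^+ k = ee (k%:R * x).
Proof.
elim: k => [|k IH]; first by rewrite mul0r ee0.
by rewrite exprS IH -eeD -natr1 mulrDl mul1r addrC.
Qed.

Lemma ee_conj x : conjc (ee x) = ee (- x).
Proof. by rewrite /ee /= mulrN cosN sinN. Qed.

Lemma commute_scale_exp (c : R[i]) (v u : A) j k :
  v * u = c *: (u * v) -> v ^+ j * u ^+ k = c ^+ (j * k) *: (u ^+ k * v ^+ j).
Proof.
move=> vu; have vuk : v * u ^+ k = c ^+ k *: (u ^+ k * v).
  elim: k => [|k IH]; first by rewrite !expr0 mulr1 mul1r scale1r.
  rewrite [u ^+ _]exprS mulrA vu -scalerAl -[u * v * _]mulrA IH -scalerAr scalerA mulrA.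
  by rewrite -!exprS.
elim: j => [|j IH]; first by rewrite mul0n !expr0 mulr1 mul1r scale1r.
rewrite [v ^+ _]exprS -[v * _ * _]mulrA IH -scalerAr [v * (_ * _)]mulrA vuk -scalerAl scalerA.
by rewrite -mulrA mulSn exprD [c ^+ k * _]mulrC.
Qed.

Lemma scale_mul (c d : R[i]) (u v : A) : (c *: u) * (d *: v) = (c * d) *: (u * v).
Proof. by rewrite -scalerAl -scalerAr scalerA. Qed.

Variables (rho : R) (U V : A).
Hypotheses (uU : unitary S U) (uV : unitary S V) (VU : V * U = ee rho *: (U * V)).

Lemma upow_star u n : star S (upow S u n) = upow S u (- n).
Proof.
case: n => [[|k]|k] /=; first by rewrite expr0 star1.
- by rewrite star_exp.
- by rewrite star_exp starK.
Qed.

Lemma upow_double u n : upow S u (2 * n) = upow S u n * upow S u n.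
Proof.
case: n => k.
  by rewrite -PoszM /= mul2n -addnn exprD.
have -> : 2 * Negz k = Negz (k.+1 + k) by lia.
by rewrite /= -exprD; congr (_ ^+ _); lia.
Qed.

Lemma unitaryZ (c : R[i]) u : conjc c * c = 1 -> unitary S u -> unitary S (c *: u).
Proof.
move=> cc [u1 u2]; rewrite /unitary starZc !scale_mul u1 u2.
by rewrite [c * _]mulrC cc !scale1r.
Qed.

Lemma unitaryM u v : unitary S u -> unitary S v -> unitary S (u * v).
Proof.
move=> [u1 u2] [v1 v2]; rewrite /unitary starM; split.
  by rewrite -mulrA (mulrA (star S u)) u1 mul1r v1.
by rewrite -mulrA (mulrA v) v2 mul1r u2.
Qed.

Lemma unitary_exp u k : unitary S u -> unitary S (u ^+ k).
Proof.
move=> uu; elim: k => [|k IH]; first by rewrite /unitary expr0 star1 mulr1.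
by rewrite exprS; exact: unitaryM.
Qed.

Lemma unitary_upow u n : unitary S u -> unitary S (upow S u n).
Proof.
move=> uu; case: n => k; first exact: unitary_exp.
by apply: unitary_exp; case: uu => u1 u2; rewrite /unitary starK.
Qed.

(** Conjugating the relation by [u] replaces [u] by its inverse and [c] by [d], the inverse of
    [c]. *)
Lemma commute_star_r (c d : R[i]) u v : unitary S u -> d * c = 1 ->
  v * u = c *: (u * v) -> v * star S u = d *: (star S u * v).
Proof.
move=> [u1 u2] dc vu; have uv : u * v = d *: (v * u) by rewrite vu scalerA dc scale1r.
rewrite -[v * star S u]mul1r -u1 -(mulrA _ u) (mulrA u v) uv -scalerAl.
by rewrite -(mulrA v) u2 mulr1 -scalerAr.
Qed.

Lemma commute_star_l (c d : R[i]) u v : unitary S v -> d * c = 1 ->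
  v * u = c *: (u * v) -> star S v * u = d *: (u * star S v).
Proof.
move=> [v1 v2] dc vu; have uv : u * v = d *: (v * u) by rewrite vu scalerA dc scale1r.
rewrite -[star S v * u]mulr1 -v2 -(mulrA _ u) (mulrA u v) uv -scalerAl -scalerAr.
by rewrite -(mulrA v u) (mulrA (star S v)) v1 mul1r.
Qed.

Lemma upow_commute m n :
  upow S V m * upow S U n = ee (rho * m%:~R * n%:~R) *: (upow S U n * upow S V m).
Proof.
have eNe x : ee (- x) * ee x = 1 by rewrite -eeD addNr ee0.
have eeN x : ee x * ee (- x) = 1 by rewrite mulrC.
have VUs := commute_star_r uU (eNe _) VU.
have VsU := commute_star_l uV (eNe _) VU.
have VsUs := commute_star_l uV (eeN _) VUs.
case: m n => [j|j] [k|k] /=.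
- rewrite (commute_scale_exp _ _ VU) eeX; congr (ee _ *: _).
  by rewrite natrM; ring.
- rewrite (commute_scale_exp _ _ VUs) eeX; congr (ee _ *: _).
  by rewrite natrM ?NegzE ?rmorphN /=; ring.
- rewrite (commute_scale_exp _ _ VsU) eeX; congr (ee _ *: _).
  by rewrite natrM ?NegzE ?rmorphN /=; ring.
- rewrite (commute_scale_exp _ _ VsUs) eeX; congr (ee _ *: _).
  by rewrite natrM ?NegzE ?rmorphN /=; ring.
Qed.

(** The phase is the one for which [weyl_star] and [weyl_double] hold without extra factors. The
    sign respects both rules and cancels the [chi] in the coefficients of the twisted sum. *)
Definition weyl m n : A :=
  (chi R m n)%:C *: (ee (rho * m%:~R * n%:~R / 2) *: (upow S U n * upow S V m)).

Lemma weyl_star m n : star S (weyl m n) = weyl (- m) (- n).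
Proof.
rewrite /weyl starZR starZc starM !upow_star upow_commute [conjc _ *: _]scalerA ee_conj -eeD.
congr (_%:C *: (ee _ *: _)); first by rewrite /chi !abszN.
by rewrite !rmorphN /=; field.
Qed.

Lemma chi_sqr m n : chi R m n * chi R m n = 1.
Proof. by rewrite /chi; case: ifP; rewrite ?mulrNN mulr1. Qed.

Lemma weyl_double m n : weyl (2 * m) (2 * n) = weyl m n ^+ 2.
Proof.
have c1 : chi R (2 * m) (2 * n) = 1 by rewrite /chi !abszM !oddM.
have XY : upow S U n * upow S V m * (upow S U n * upow S V m) =
    ee (rho * m%:~R * n%:~R) *: (upow S U (2 * n) * upow S V (2 * m)).
  rewrite !upow_double -!(mulrA (upow S U n)) scalerAr; congr (_ * _).
  by rewrite [LHS]mulrA upow_commute -scalerAl mulrA.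
rewrite /weyl !scalerA expr2 scale_mul XY scalerA c1 mul1r; congr (_ *: _).
rewrite mulrACA -rmorphM chi_sqr mul1r -!eeD; congr ee.
by rewrite !intrM; field.
Qed.

Lemma weyl_unitary m n : unitary S (weyl m n).
Proof.
apply: unitaryZ.
  by apply/eqP; rewrite eq_complex /= oppr0 !(mulr0, mul0r) subr0 addr0 chi_sqr !eqxx.
apply: unitaryZ; first by rewrite ee_conj -eeD addNr ee0.
by apply: unitaryM; exact: unitary_upow.
Qed.

End WeylOperators.

Theorem theorem6p4 (R : realType) (A : algType R[i]) (S : cstar_struct A)
    (rho : R) (U V : A) :
  1 < rho ->
  unitary S U -> unitary S V ->
  V * U = ee rho *: (U * V) ->
  exists x : A,
    cvgA S (sqsum (fun m n : int =>
       ((expR (- (pi / 2) * rho * ((m%:~R) ^+ 2 + (n%:~R) ^+ 2)))%:C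
          * ee (rho * m%:~R * n%:~R / 2)) *: (upow S U n * upow S V m))) x
    /\ positive S x /\ invertible x.
Proof.
move=> rho1 uU uV VU.
(* The exponent [pi / 2 * rho] is split as [pi / 2], where the scalar sum is nonnegative in the
   limit, plus this positive excess. *)
have be0 : 0 < pi / 2 * (rho - 1) by rewrite mulr_gt0 ?divr_gt0 ?pi_gt0 // subr_gt0.
have [x [Fx Px]] := twisted_gaussian_positive be0
  (weyl_unitary rho uU uV) (weyl_star uU uV VU) (weyl_double uU uV VU).
exists x; split=> // e /Fx [N HN]; exists N => k /HN.
congr (nrm S (_ - _) < e); apply: eq_sqsum => m n.
rewrite /weyl !scalerA; congr (_ *: _).
rewrite -rmorphM; congr (_%:C * _).
(* The two signs multiply to 1 and the Gaussians of exponents [pi / 2] and [pi / 2 * (rho - 1)]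
   merge. *)
rewrite mulrC !mulrA chi_sqr mul1r -mulrA mulrACA -!gaussD /gauss -expRD.
by congr expR; field.
Qed.
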